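(* Let $k$ be an algebraically closed field of characteristic $p>0$. Let $P$ be a cyclic group of order $p$, $C$ a cyclic group of order $m$ with $\gcd(m,p)=1$, $\chi:C\to\mathbb{F}_p^\times$ a character, and $G=P\rtimes_\chi C$. Let $\phi:G\hookrightarrow\mathrm{Aut}_k(k[[y]])$ be a local $G$-action with conductor $h$, and suppose that $\phi$ lifts to characteristic $0$. Then: (i) the character $\chi$ is either trivial or injective; (ii) if $\chi$ is injective, then $m\mid h+1$.
   Context: $P\rtimes_\chi C$ denotes the semidirect product in which $\tau\sigma\tau^{-1}=\sigma^{\chi(\tau)}$ for $\sigma\in P$, $\tau\in C$. A local $G$-action is a faithful $k$-linear action $\phi:G\hookrightarrow\mathrm{Aut}_k(k[[y]])$. Its conductor is the positive integer $h=\mathrm{ord}_y\left(\frac{\sigma(y)}{y}-1\right)$, where $\sigma$ is a generator of $P$. We say that $\phi$ lifts to characteristic $0$ if there exist a complete discrete valuation ring $R$ with residue field $k$ and fraction field of characteristic zero, and an $R$-linear action $\phi_R:G\hookrightarrow\mathrm{Aut}_R(R[[y]])$ whose reduction to $k[[y]]$ is $\phi$. *)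

(* Defs.v *)
From HB Require Import structures.
From mathcomp Require Import all_boot all_order all_algebra.
From mathcomp Require Import all_fingroup all_solvable.
From mathcomp Require Import boolp.
Set Implicit Arguments.
Unset Strict Implicit.
Unset Printing Implicit Defensive.
Import GRing.Theory.
Local Open Scope ring_scope.

Record fps (R : Type) : Type := FPS { fps_coef : nat -> R }.

HB.instance Definition _ (R : Type) := gen_eqMixin (fps R).
HB.instance Definition _ (R : Type) := gen_choiceMixin (fps R).

Lemma fpsP (R : Type) (f g : fps R) : fps_coef f =1 fps_coef g -> f = g.
Proof. by case: f g => [f] [g] /= /funext ->. Qed.

Section FpsRing.
Variable R : comNzRingType.
Implicit Types (f g h : fps R) (a b : R).

Definition fps_zero : fps R := FPS (fun=> 0).
Definition fps_opp f : fps R := FPS (fun n => - fps_coef f n).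
Definition fps_add f g : fps R := FPS (fun n => fps_coef f n + fps_coef g n).
Definition fps_one : fps R := FPS (fun n => (n == 0%N)%:R).
Definition fps_mul f g : fps R :=
  FPS (fun n => \sum_(i < n.+1) fps_coef f i * fps_coef g (n - i)%N).
Definition fps_scale a f : fps R := FPS (fun n => a * fps_coef f n).
Definition fps_X : fps R := FPS (fun n => (n == 1%N)%:R).

Fact fps_addA : associative fps_add.
Proof. by move=> f g h; apply: fpsP => n /=; rewrite addrA. Qed.
Fact fps_addC : commutative fps_add.
Proof. by move=> f g; apply: fpsP => n /=; rewrite addrC. Qed.
Fact fps_add0 : left_id fps_zero fps_add.
Proof. by move=> f; apply: fpsP => n /=; rewrite add0r. Qed.
Fact fps_addN : left_inverse fps_zero fps_opp fps_add.
Proof. by move=> f; apply: fpsP => n /=; rewrite addNr. Qed.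

HB.instance Definition _ := GRing.isZmodule.Build (fps R)
  fps_addA fps_addC fps_add0 fps_addN.

Definition fps_trunc m f : {poly R} := \poly_(i < m) fps_coef f i.

Fact coef_fps_trunc m f i : (i < m)%N -> (fps_trunc m f)`_i = fps_coef f i.
Proof. by rewrite coef_poly => ->. Qed.

Fact fps_mul_trunc m f g n : (n < m)%N ->
  fps_coef (fps_mul f g) n = (fps_trunc m f * fps_trunc m g)`_n.
Proof.
move=> nm; rewrite coefM; apply: eq_bigr => i _; rewrite !coef_fps_trunc //.
  exact: leq_ltn_trans (leq_subr _ _) nm.
by apply: leq_trans nm; rewrite ltn_ord.
Qed.

Fact fps_mulC : commutative fps_mul.
Proof.
by move=> f g; apply: fpsP => n; rewrite !(@fps_mul_trunc n.+1) // mulrC.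
Qed.

Fact fps_mulA : associative fps_mul.
Proof.
move=> f g h; apply: fpsP => n.
transitivity ((fps_trunc n.+1 f * (fps_trunc n.+1 g * fps_trunc n.+1 h))`_n).
  rewrite coefM; apply: eq_bigr => i _; rewrite coef_fps_trunc //.
  by congr (_ * _); apply: fps_mul_trunc; rewrite ltnS leq_subr.
rewrite mulrA coefM; apply: eq_bigr => i _.
rewrite coef_fps_trunc ?ltnS ?leq_subr //; congr (_ * _).
by symmetry; apply: fps_mul_trunc.
Qed.

Fact fps_mul1 : left_id fps_one fps_mul.
Proof.
move=> f; apply: fpsP => n /=; rewrite big_ord_recl /= mul1r subn0.
by rewrite big1 ?addr0 // => i _; rewrite /= mul0r.
Qed.

Fact fps_mulD : left_distributive fps_mul fps_add.
Proof.
move=> f g h; apply: fpsP => n /=; rewrite -big_split /=.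
by apply: eq_bigr => i _; rewrite mulrDl.
Qed.

Fact fps_one_neq0 : fps_one != 0 :> fps R.
Proof.
apply/eqP => /(congr1 (fun f => fps_coef f 0)) /= /eqP.
by rewrite oner_eq0.
Qed.

HB.instance Definition _ := GRing.Zmodule_isComNzRing.Build (fps R)
  fps_mulA fps_mulC fps_mul1 fps_mulD fps_one_neq0.

Fact fps_scaleA a b f : fps_scale a (fps_scale b f) = fps_scale (a * b) f.
Proof. by apply: fpsP => n /=; rewrite mulrA. Qed.
Fact fps_scale1 : left_id 1 fps_scale.
Proof. by move=> f; apply: fpsP => n /=; rewrite mul1r. Qed.
Fact fps_scaleDr : right_distributive fps_scale +%R.
Proof. by move=> a f g; apply: fpsP => n /=; rewrite mulrDr. Qed.
Fact fps_scaleDl f : {morph fps_scale^~ f : a b / a + b}.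
Proof. by move=> a b; apply: fpsP => n /=; rewrite mulrDl. Qed.

HB.instance Definition _ := GRing.Zmodule_isLmodule.Build R (fps R)
  fps_scaleA fps_scale1 fps_scaleDr fps_scaleDl.

Fact fps_scaleAl a f g : a *: (f * g) = (a *: f) * g.
Proof.
apply: fpsP => n /=; rewrite big_distrr /=.
by apply: eq_bigr => i _; rewrite mulrA.
Qed.

HB.instance Definition _ := GRing.Lmodule_isLalgebra.Build R (fps R) fps_scaleAl.
HB.instance Definition _ := GRing.Lalgebra_isComAlgebra.Build R (fps R).

Definition has_ord f n : Prop :=
  fps_coef f n != 0 /\ forall i, (i < n)%N -> fps_coef f i = 0.

End FpsRing.

Arguments fps_X {R}.

Definition fps_map (R S : Type) (r : R -> S) (f : fps R) : fps S :=
  FPS (fun n => r (fps_coef f n)).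

(* The values of phi outside of G are irrelevant.  An abstract R-algebra
   automorphism of R[[y]] is automatically continuous when R is a field or a
   complete discrete valuation ring, so no continuity is required. *)
Definition faithful_action (R : comNzRingType) (gT : finGroupType)
    (G : {group gT}) (phi : gT -> {lrmorphism fps R -> fps R}) : Prop :=
  [/\ {in G, forall g, bijective (phi g)},
      {in G &, forall g h, phi (g * h)%g =1 phi g \o phi h}
    & {in G &, forall g h, phi g =1 phi h -> g = h}].

(* The series u is sigma(y)/y. *)
Definition has_conductor (R : comNzRingType) (gT : finGroupType)
    (P : {group gT}) (phi : gT -> {lrmorphism fps R -> fps R}) (h : nat) : Prop :=
  exists2 sigma, generator P sigma
    & exists u : fps R, phi sigma fps_X = fps_X * u /\ has_ord (u - 1) h.

Section DVR.
Variable R : idomainType.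

Definition is_ideal (I : R -> Prop) : Prop :=
  [/\ I 0, forall x y, I x -> I y -> I (x + y) & forall a x, I x -> I (a * x)].

Definition generates (d : R) (I : R -> Prop) : Prop :=
  forall x, I x <-> exists a, x = a * d.

Definition is_pid : Prop :=
  forall I, is_ideal I -> exists d, generates d I.

Definition nonunit (x : R) : Prop := x \isn't a GRing.unit.

Definition is_dvr : Prop :=
  [/\ is_pid, is_ideal nonunit & exists2 x, nonunit x & x != 0].

(* If pi generates the maximal ideal m, then cong_pow pi n is congruence
   modulo m^n. *)
Definition cong_pow (pi : R) (n : nat) (x y : R) : Prop :=
  exists a, x - y = a * pi ^+ n.

Definition adically_complete : Prop :=
  forall pi, generates pi nonunit -> forall u : nat -> R,
    (forall n, exists N, forall i j, (N <= i)%N -> (N <= j)%N ->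
      cong_pow pi n (u i) (u j)) ->
    exists l, forall n, exists N, forall i, (N <= i)%N -> cong_pow pi n (u i) l.

(* red identifies the residue field of the local ring R with k. *)
Definition residue_map (k : fieldType) (red : {rmorphism R -> k}) : Prop :=
  (forall c, exists x, red x = c) /\ (forall x, red x = 0 <-> nonunit x).

End DVR.

Definition lifts_to_char0 (k : fieldType) (gT : finGroupType) (G : {group gT})
    (phi : gT -> {lrmorphism fps k -> fps k}) : Prop :=
  exists (R : idomainType) (red : {rmorphism R -> k})
         (phiR : gT -> {lrmorphism fps R -> fps R}),
    [/\ is_dvr R, adically_complete R, residue_map red,
        [pchar {fraction R}] =i pred0
      & faithful_action G phiR /\
        {in G, forall g f, fps_map red (phiR g f) = phi g (fps_map red f)}].

(* Main.v *)
(** Let A = R[[y]]/(f) with f = sigma(y) - y; by Weierstrass division A is free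
    of rank h + 1 over R.  The series theta = sigma(f)/f (the multiplier of sigma
    at its fixed points) satisfies 1 + theta + ... + theta^(p-1) = 0 in A, and
    tau(theta) = theta^chi(tau) in A for tau in C.

    (ii) If chi(tau) <> 1, conjugating by powers of theta shows that the trace of
    theta^i tau on A does not depend on i, so p times the trace of tau vanishes and
    tau has trace 0.  Modulo the maximal ideal that trace is the sum of zeta^i for
    i <= h, where phi(tau)(y) = zeta y + ...; hence zeta^(h+1) = 1, and tau |-> zeta
    is faithful on C because the action of C is tame.

    (i) A nontrivial t in ker chi has exactly one fixed point in the open disc.  It
    is R-rational and is fixed by all of G, so theta specializes there to some r in
    R with 1 + r + ... + r^(p-1) = 0 and r^chi(tau) = r, which forces chi(tau) = 1. *)

Require Import Defs.
From HB Require Import structures.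
From mathcomp Require Import all_boot all_order all_algebra.
From mathcomp Require Import all_fingroup all_solvable.
From mathcomp Require Import boolp ring.
Set Implicit Arguments.
Unset Strict Implicit.
Unset Printing Implicit Defensive.
Import GRing.Theory.
Local Open Scope group_scope.

(** * Coefficients, shifts and units of formal power series *)

Section PowerSeries.
Local Open Scope ring_scope.
Variable R : comNzRingType.
Implicit Types (f g : fps R) (a : R).

Lemma fps_coefD f g n : fps_coef (f + g) n = fps_coef f n + fps_coef g n.
Proof. by []. Qed.

Lemma fps_coefN f n : fps_coef (- f) n = - fps_coef f n.
Proof. by []. Qed.

Lemma fps_coefZ a f n : fps_coef (a *: f) n = a * fps_coef f n.
Proof. by []. Qed.

Lemma fps_coefM f g n :
  fps_coef (f * g) n = \sum_(i < n.+1) fps_coef f i * fps_coef g (n - i)%N.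
Proof. by []. Qed.

Lemma fps_coef1 n : fps_coef (1 : fps R) n = (n == 0%N)%:R.
Proof. by []. Qed.

Lemma fps_coef_sum I (r : seq I) (P : pred I) (F : I -> fps R) n :
  fps_coef (\sum_(i <- r | P i) F i) n = \sum_(i <- r | P i) fps_coef (F i) n.
Proof. exact: (big_morph (fun f => fps_coef f n)). Qed.

Lemma fps_coefXM g n :
  fps_coef (fps_X * g) n = if n is n'.+1 then fps_coef g n' else 0.
Proof.
rewrite fps_coefM; case: n => [|n]; first by rewrite big_ord1 mul0r.
rewrite big_ord_recl mul0r add0r big_ord_recl mul1r subSS subn0.
by rewrite big1 ?addr0 // => i _; rewrite mul0r.
Qed.

Lemma fps_coefXnM d g n :
  fps_coef (fps_X ^+ d * g) n = if (n < d)%N then 0 else fps_coef g (n - d)%N.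
Proof.
elim: d n => [|d IHd] n; first by rewrite expr0 mul1r subn0.
by rewrite exprS -mulrA fps_coefXM; case: n => // n; rewrite IHd ltnS subSS.
Qed.

Lemma fps_coefXn d n : fps_coef (fps_X ^+ d : fps R) n = (n == d)%:R.
Proof.
rewrite -[fps_X ^+ d]mulr1 fps_coefXnM fps_coef1 subn_eq0 eqn_leq.
by case: ltnP; rewrite ?andbT ?andbF.
Qed.

Definition fps_shift d f : fps R := FPS (fun n => fps_coef f (n + d)%N).

Lemma fps_shiftE d f :
  f = \sum_(i < d) fps_coef f i *: fps_X ^+ i + fps_X ^+ d * fps_shift d f.
Proof.
apply: fpsP => n; rewrite fps_coefD fps_coef_sum fps_coefXnM.
under eq_bigr => i _ do rewrite fps_coefZ fps_coefXn.
case: ltnP => [nd|dn].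
  rewrite (bigD1 (Ordinal nd)) //= eqxx mulr1 big1 ?addr0 // => i.
  by rewrite -val_eqE /= eq_sym => /negPf ->; rewrite mulr0.
rewrite /= subnK // big1 ?add0r // => i _.
by rewrite gtn_eqF ?mulr0 // (leq_trans (ltn_ord i)).
Qed.

Lemma fps_coef0M f g : fps_coef (f * g) 0 = fps_coef f 0 * fps_coef g 0.
Proof. by rewrite fps_coefM big_ord1. Qed.

Lemma fps_coef0X f n : fps_coef (f ^+ n) 0 = fps_coef f 0 ^+ n.
Proof. by elim: n => // n IHn; rewrite !exprS fps_coef0M IHn. Qed.

End PowerSeries.

Section Invertible.
Local Open Scope ring_scope.

(** Write [f = a *: (1 - fps_X * t)] and invert by the geometric series in [fps_X * t], of which
    only the first [n.+1] terms reach coefficient [n]. *)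
Lemma fps_unit (R : comUnitRingType) (f : fps R) :
  fps_coef f 0 \is a GRing.unit -> exists g, f * g = 1.
Proof.
set a := fps_coef f 0 => ua.
pose t := - (a^-1 *: fps_shift 1 f).
have fE : f = a *: (1 - fps_X * t).
  rewrite [LHS](fps_shiftE 1) big_ord1 !expr0 expr1 scalerBr; congr (_ + _).
  by rewrite /t mulrN scalerN opprK -scalerAr scalerA divrr // scale1r.
pose S n := \sum_(i < n) (fps_X * t) ^+ i.
have S_stable n N : (n < N)%N -> fps_coef (S N) n = fps_coef (S n.+1) n.
  rewrite /S -!(big_mkord xpredT (fun i => (fps_X * t) ^+ i)) => nN.
  rewrite !fps_coef_sum (@big_cat_nat _ _ _ n.+1) //= -[RHS]addr0.
  congr (_ + _); rewrite big_nat big1 // => i /andP[ni _].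
  by rewrite exprMn fps_coefXnM ni.
exists (a^-1 *: FPS (fun n => fps_coef (S n.+1) n)).
rewrite fE -scalerAl -scalerAr scalerA divrr // scale1r.
apply: fpsP => n; transitivity (fps_coef ((1 - fps_X * t) * S n.+1) n).
  rewrite !fps_coefM; apply: eq_bigr => i _; congr (_ * _).
  by rewrite /= -(@S_stable _ n.+1) // ltnS leq_subr.
rewrite -opprB mulNr -subrX1 opprB fps_coefD fps_coefN exprMn.
by rewrite fps_coefXnM ltnSn subr0.
Qed.

End Invertible.

Section FpsMap.
Local Open Scope ring_scope.
Variables (R S : comNzRingType) (r : {rmorphism R -> S}).

Fact fps_map_is_zmod_morphism : zmod_morphism (fps_map r).
Proof. by move=> f g; apply: fpsP => n; rewrite /= rmorphB. Qed.

Fact fps_map_is_monoid_morphism : monoid_morphism (fps_map r).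
Proof.
split=> [|f g]; apply: fpsP => n; first by rewrite /= rmorph_nat.
by rewrite /= rmorph_sum; apply: eq_bigr => i _; rewrite rmorphM.
Qed.

HB.instance Definition _ :=
  GRing.isZmodMorphism.Build (fps R) (fps S) (fps_map r) fps_map_is_zmod_morphism.
HB.instance Definition _ :=
  GRing.isMonoidMorphism.Build (fps R) (fps S) (fps_map r)
    fps_map_is_monoid_morphism.

Lemma fps_mapX : fps_map r fps_X = fps_X.
Proof. by apply: fpsP => n; rewrite /= rmorph_nat. Qed.

End FpsMap.

(** * Congruences modulo a principal ideal *)

Section Congruence.
Local Open Scope ring_scope.
Variables (S : comNzRingType) (f : S).

(** The quotient ring by [f] is never formed: its elements are handled through representatives. *)
Definition cong (a b : S) : Prop := exists q, a = b + f * q.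

Lemma cong_refl a : cong a a.
Proof. by exists 0; rewrite mulr0 addr0. Qed.

Lemma cong_sym a b : cong a b -> cong b a.
Proof. by case=> q ->; exists (- q); rewrite mulrN addrK. Qed.

Lemma cong_trans b a c : cong a b -> cong b c -> cong a c.
Proof. by case=> q -> [q' ->]; exists (q' + q); rewrite mulrDr addrA. Qed.

Lemma congD a b a' b' : cong a b -> cong a' b' -> cong (a + a') (b + b').
Proof. by case=> q -> [q' ->]; exists (q + q'); rewrite mulrDr addrACA. Qed.

Lemma congMl c a b : cong a b -> cong (c * a) (c * b).
Proof. by case=> q ->; exists (c * q); rewrite mulrDr mulrCA. Qed.

Lemma congM a b a' b' : cong a b -> cong a' b' -> cong (a * a') (b * b').
Proof.
move=> ab ab'; apply: (@cong_trans (a * b')); first exact: congMl.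
by rewrite ![_ * b']mulrC; apply: congMl.
Qed.

Lemma congX n a b : cong a b -> cong (a ^+ n) (b ^+ n).
Proof.
move=> ab; elim: n => [|n IHn]; first by rewrite !expr0; apply: cong_refl.
by rewrite !exprS; apply: congM.
Qed.

Lemma cong_sum I (r : seq I) (F G : I -> S) :
  (forall i, cong (F i) (G i)) -> cong (\sum_(i <- r) F i) (\sum_(i <- r) G i).
Proof.
move=> FG; elim: r => [|i r IHr]; first by rewrite !big_nil; apply: cong_refl.
by rewrite !big_cons; apply: congD.
Qed.

Lemma cong_sub0 a b : cong (a - b) 0 <-> cong a b.
Proof.
split=> -[q]; first by rewrite add0r => /eqP; rewrite subr_eq addrC => /eqP; exists q.
by move=> ->; exists q; rewrite addrC addKr add0r.
Qed.

End Congruence.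

(** * Weierstrass division over a complete discrete valuation ring *)

Section Weierstrass.
Local Open Scope ring_scope.
Variables (R : idomainType) (k : fieldType) (red : {rmorphism R -> k}) (pi : R).
Hypothesis dvrR : is_dvr R.
Hypothesis complR : adically_complete R.
Hypothesis resR : residue_map red.
Hypothesis piR : generates pi (@nonunit R).
Implicit Types (f g q w : fps R) (x : R).

Lemma red_eq0 x : red x = 0 -> exists a, x = a * pi.
Proof. by case: resR => _ /(_ x)[redx _] /redx /piR. Qed.

Lemma red_unit x : red x != 0 -> x \is a GRing.unit.
Proof. by apply: contraNT => /(resR.2 x)/eqP. Qed.

Lemma pi_neq0 : pi != 0.
Proof.
case: dvrR => _ _ [x /piR[a ->]]; apply: contra => /eqP ->.
by rewrite mulr0.
Qed.

(* Krull intersection: the ideal {z | z pi^N in (x) for some N} is generated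
   by some b, and b would have to be a multiple of b pi. *)
Lemma pi_separated x : (forall N, exists a, x = a * pi ^+ N) -> x = 0.
Proof.
move=> divx; apply/eqP/negPn/negP => x_neq0.
pose I z := exists N a, z * pi ^+ N = a * x.
have I_ideal : is_ideal I.
  split=> [|y z [N [a Ny]] [M [b Mz]]|c z [N [a Nz]]].
  - by exists 0%N, 0; rewrite !mul0r.
  - exists (N + M)%N, (a * pi ^+ M + b * pi ^+ N).
    rewrite exprD mulrDl mulrA Ny (mulrC (pi ^+ N)) mulrA Mz mulrDl.
    by rewrite mulrAC (mulrAC b).
  - by exists N, (c * a); rewrite -!mulrA Nz.
have [pidR _ _] := dvrR; have [b bI] := pidR I I_ideal.
have /bI[N [a bNx]] : exists c, b = c * b by exists 1; rewrite mul1r.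
have [e xe] := divx N.+1.
have /bI[s es] : I e by exists N.+1, 1; rewrite mul1r.
have piN0 : pi ^+ N != 0 by rewrite expf_neq0 ?pi_neq0.
have b_neq0 : b != 0.
  by apply: contra x_neq0 => /eqP b0; rewrite xe es b0 mulr0 mul0r.
have : b * (1 - s * a * pi) = 0.
  apply: (mulIf piN0); rewrite mul0r mulrBr mulr1 mulrBl bNx {1}xe es exprS.
  by ring.
move/eqP; rewrite mulf_eq0 (negPf b_neq0) subr_eq0 => /eqP sapi.
have : nonunit (1 : R) by apply/piR; exists (s * a).
by rewrite /nonunit unitr1.
Qed.

Lemma fps_pi_separated f : (forall N, exists g, f = pi ^+ N *: g) -> f = 0.
Proof.
move=> divf; apply: fpsP => n; apply: pi_separated => N.
by have [g ->] := divf N; exists (fps_coef g n); rewrite fps_coefZ mulrC.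
Qed.

(** The partial sums are Cauchy. Their limit [l] is compared with truncation [N] through a partial
    sum far enough out to be congruent to [l] modulo [pi ^+ N]. *)
Lemma pi_series (a : nat -> R) :
  exists l, forall N, exists s, l = \sum_(n < N) pi ^+ n * a n + pi ^+ N * s.
Proof.
pose u N := \sum_(n < N) pi ^+ n * a n.
have u_tail N M : exists s, u (N + M)%N = u N + pi ^+ N * s.
  exists (\sum_(n < M) pi ^+ n * a (N + n)%N).
  rewrite /u big_split_ord /= mulr_sumr; congr (_ + _).
  by apply: eq_bigr => i _; rewrite exprD mulrA.
have [N|l ul] := complR piR (u := u).
  exists N => i j Ni Nj; have [s] := u_tail N (i - N)%N.
  have [t] := u_tail N (j - N)%N; rewrite !subnKC // => -> ->.
  by exists (s - t); rewrite opprD addrACA subrr add0r -mulrBr mulrC.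
exists l => N; have [M Ml] := ul N.
have [b lE] := Ml (N + M)%N (leq_addl _ _); have [s uE] := u_tail N M.
exists (s - b); have -> : l = u (N + M)%N - b * pi ^+ N by rewrite -lE subKr.
by rewrite uE /u; ring.
Qed.

Lemma fps_pi_series (a : nat -> fps R) :
  exists l, forall N, exists s,
    l = \sum_(n < N) pi ^+ n *: a n + pi ^+ N *: s.
Proof.
have /choice[l lP] j := pi_series (fun n => fps_coef (a n) j).
exists (FPS l) => N; have /choice[s sP] j := lP j N.
exists (FPS s); apply: fpsP => j; rewrite fps_coefD fps_coef_sum [LHS]sP.
by rewrite fps_coefZ; congr (_ + _); apply: eq_bigr => i _; rewrite fps_coefZ.
Qed.

Lemma fps_red_eq0 f : fps_map red f = 0 -> exists g, f = pi *: g.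
Proof.
move=> rf0; have /choice[g gP] n : exists a, fps_coef f n = a * pi.
  by apply: red_eq0; apply: (congr1 (fun s => fps_coef s n) rf0).
by exists (FPS g); apply: fpsP => n; rewrite gP fps_coefZ mulrC.
Qed.

(** The coefficients from degree [d] on form a unit [v], since the first of them is nonzero in [k];
    those below [d] are divisible by [pi] and are absorbed into [w]. *)
Lemma weierstrass_form f d : has_ord (fps_map red f) d ->
  exists v v' w, v * v' = 1 /\ f = v * (fps_X ^+ d - pi *: w).
Proof.
case=> rfd rf0; pose v := fps_shift d f; pose r := f - fps_X ^+ d * v.
have [v' vv'] : exists v', v * v' = 1 by apply/fps_unit/red_unit.
have [r1 rE] : exists r1, r = pi *: r1.
  apply: fps_red_eq0; apply: fpsP => n.
  change (red (fps_coef r n) = 0); rewrite fps_coefD fps_coefN fps_coefXnM.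
  case: ltnP => [nd|dn]; first by rewrite subr0; apply: rf0.
  by rewrite /= subnK // subrr rmorph0.
exists v, v', (- (v' * r1)); split=> //.
rewrite scalerN opprK mulrDr -scalerAr mulrA vv' mul1r -rE /r.
by rewrite [v * _]mulrC addrC subrK.
Qed.

(** The powers of the variable below [d] span the quotient by [f], and they are independent there,
    because [q = 0] forces the coefficients to vanish. *)
Definition weierstrass_exact f d :=
  (forall g, exists (c : nat -> R) q, g = \sum_(i < d) c i *: fps_X ^+ i + f * q)
  /\ (forall (c : nat -> R) q, \sum_(i < d) c i *: fps_X ^+ i = f * q -> q = 0).

Lemma weierstrass_division f d :
  has_ord (fps_map red f) d -> weierstrass_exact f d.
Proof.
case/weierstrass_form=> v [v' [w [vv' ->]]] {f}.
have shiftB f g : fps_shift d (f - g) = fps_shift d f - fps_shift d g.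
  exact: fpsP.
have shiftZ a f : fps_shift d (a *: f) = a *: fps_shift d f by exact: fpsP.
split=> [g|c q].
  (* Modulo [X^d - pi w], multiplication by [X^d] is multiplication by [pi w],
     so [g] is reduced by summing the geometric series of [pi E]. *)
  pose E g := w * fps_shift d g.
  have EB f1 f2 : E (f1 - f2) = E f1 - E f2 by rewrite /E shiftB mulrBr.
  have EZ a f1 : E (a *: f1) = a *: E f1 by rewrite /E shiftZ -scalerAr.
  have ED f1 f2 : E (f1 + f2) = E f1 + E f2.
    by rewrite -[f2]opprK EB -!scaleN1r !EZ !scaleN1r opprK.
  have E0 : E 0 = 0 by rewrite -(scale0r 0) EZ !scale0r.
  have [l lP] := fps_pi_series (fun n => iter n E g).
  have gE : g = l - pi *: E l.
    apply/eqP; rewrite -subr_eq0; apply/eqP/fps_pi_separated => N.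
    have [s ->] := lP N.
    exists (iter N E g - s + pi *: E s).
    have -> : E (\sum_(i < N) pi ^+ i *: iter i E g + pi ^+ N *: s) =
        \sum_(i < N) pi ^+ i *: iter i.+1 E g + pi ^+ N *: E s.
      rewrite ED EZ (big_morph E ED E0); congr (_ + _).
      by apply: eq_bigr => i _; rewrite EZ.
    have tele : \sum_(i < N) pi ^+ i *: iter i E g =
        g - pi ^+ N *: iter N E g + pi *: \sum_(i < N) pi ^+ i *: iter i.+1 E g.
      elim: N {lP s} => [|N IHN].
        by rewrite !big_ord0 expr0 scale1r scaler0 subrr addr0.
      rewrite !big_ord_recr IHN /= scalerDr !scalerA -exprS.
      set a1 := _ *: iter N E g; set a2 := pi *: _; set a3 := _ *: E _.
      by ring.
    rewrite tele !scalerDr scalerN !scalerA [pi * _]mulrC.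
    set a1 := _ *: iter N E g; set a2 := _ *: s; set a3 := _ *: E s.
    set a4 := pi *: _; ring.
  (* The coefficients of [l] below [d] are the remainder, the rest of [l] is the quotient by
     [fps_X ^+ d - pi *: w], and [v'] compensates the unit [v]. *)
  exists (fps_coef l), (v' * fps_shift d l).
  rewrite mulrACA vv' mul1r mulrBl -scalerAl addrA -fps_shiftE.
  exact: gE.
(* Shifting by [d] kills the remainder and leaves [u = pi *: fps_shift d (w * u)], so [u] is
   divisible by every power of [pi]. *)
set u := v * q; rewrite mulrAC -/u mulrC => /(congr1 (fps_shift d)) eq_u.
have {eq_u} uE : u = pi *: fps_shift d (w * u).
  have low0 : fps_shift d (\sum_(i < d) c i *: fps_X ^+ i) = 0.
    apply: fpsP => n /=; rewrite fps_coef_sum big1 // => i _.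
    by rewrite fps_coefZ fps_coefXn gtn_eqF ?mulr0 // ltn_addl.
  have high : fps_shift d (fps_X ^+ d * u) = u.
    apply: fpsP => n; change (fps_coef (fps_X ^+ d * u) (n + d)%N = fps_coef u n).
    by rewrite fps_coefXnM ltnNge leq_addl addnK.
  move: eq_u; rewrite low0 mulrBl shiftB high -scalerAl shiftZ.
  by move/esym/eqP; rewrite subr_eq0 => /eqP.
have u0 : u = 0.
  apply: fps_pi_separated; elim=> [|N [s us]]; first by exists u; rewrite scale1r.
  exists (fps_shift d (w * s)).
  by rewrite {1}uE {1}us -scalerAr shiftZ scalerA -exprS.
by rewrite -[q]mul1r -vv' mulrAC -/u u0 mul0r.
Qed.

End Weierstrass.

(** * The quotient by a series of Weierstrass degree [d] *)

Section WeierstrassQuotient.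
Local Open Scope ring_scope.
Variables (R : idomainType) (k : fieldType) (red : {rmorphism R -> k}) (pi : R).
Hypothesis dvrR : is_dvr R.
Hypothesis complR : adically_complete R.
Hypothesis resR : residue_map red.
Hypothesis piR : generates pi (@nonunit R).
Variables (f : fps R) (d : nat).
Hypothesis ordf : has_ord (fps_map red f) d.

Let exactf := weierstrass_division dvrR complR resR piR ordf.

Lemma congZ a g g' : cong f g g' -> cong f (a *: g) (a *: g').
Proof. by case=> q ->; exists (a *: q); rewrite scalerDr -scalerAr. Qed.

Lemma sum_fps_X_coef (c : nat -> R) j : (j < d)%N ->
  fps_coef (\sum_(i < d) c i *: fps_X ^+ i) j = c j.
Proof.
move=> jd; rewrite fps_coef_sum (bigD1 (Ordinal jd)) // big1 => [|i].
  by rewrite fps_coefZ fps_coefXn eqxx mulr1 /= addr0.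
rewrite fps_coefZ fps_coefXn -val_eqE /= eq_sym => /negPf ij.
by rewrite ij mulr0.
Qed.

Lemma weierstrass_regular a b : f * a = f * b -> a = b.
Proof.
move=> fab; apply/eqP; rewrite -subr_eq0; apply/eqP.
apply: (exactf.2 (fun=> 0)); rewrite mulrBr fab subrr big1 // => i _.
exact: scale0r.
Qed.

Lemma weierstrass_uniq (c c' : nat -> R) :
  cong f (\sum_(i < d) c i *: fps_X ^+ i) (\sum_(i < d) c' i *: fps_X ^+ i) ->
  forall j, (j < d)%N -> c j = c' j.
Proof.
case=> q cc' j jd; have q0 : q = 0.
  apply: (exactf.2 (fun i => c i - c' i)).
  under eq_bigr => i _ do rewrite scalerBl.
  by rewrite sumrB cc' addrC addKr.
by rewrite -(sum_fps_X_coef c jd) cc' q0 mulr0 addr0 sum_fps_X_coef.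
Qed.

Lemma weierstrass_const a : (0 < d)%N -> cong f a%:A 0 -> a = 0.
Proof.
move=> d_gt0 fa; rewrite -[LHS]/((fun i : nat => if i is 0 then a else 0) 0%N).
apply: (@weierstrass_uniq _ (fun=> 0)) d_gt0.
case: d => [|n]; first by rewrite !big_ord0; apply: cong_refl.
rewrite [X in cong _ _ X]big1 => [|i _]; last by rewrite scale0r.
rewrite big_ord_recl big1 => [|i _]; last by rewrite scale0r.
by rewrite addr0.
Qed.

(** Modulo [f] the series [fps_X ^+ d] is a multiple of [pi], so the remainder of [g] is divisible
    by every power of [pi]. *)
Lemma weierstrass_adic g :
  (forall n, exists s, cong f g (fps_X ^+ n * s)) -> cong f g 0.
Proof.
move=> gX; have [c [q gE]] := exactf.1 g.
have [v [v' [w [vv' fE]]]] := weierstrass_form resR piR ordf.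
have Xd : cong f (fps_X ^+ d) (pi *: w).
  by exists v'; rewrite fE mulrAC vv' mul1r addrC subrK.
have c0 i : (i < d)%N -> c i = 0.
  move=> id; apply: (pi_separated dvrR piR) => N.
  have [s gs] := gX (d * N)%N.
  have [c' [q' sE]] := exactf.1 (w ^+ N * s).
  exists (c' i); rewrite mulrC.
  apply: (@weierstrass_uniq c (fun i => pi ^+ N * c' i)) => //.
  apply: (@cong_trans _ _ g); first by exists (- q); rewrite gE mulrN addrK.
  apply: (cong_trans gs); rewrite exprM.
  apply: (@cong_trans _ _ ((pi *: w) ^+ N * s)).
    by apply: congM (cong_refl _ _); apply: congX.
  exists (pi ^+ N *: q'); rewrite exprZn -scalerAl sE scalerDr -scalerAr.
  by congr (_ + _); rewrite scaler_sumr; apply: eq_bigr => j _; rewrite scalerA.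
exists q; rewrite gE big1 // => i _; by rewrite c0 ?scale0r.
Qed.

(* No continuity is needed: rho a and a differ by a multiple of X^n modulo
   [rho X - X] for every n, and the quotient is X-adically separated. *)
Lemma aut_cong (rho : {lrmorphism fps R -> fps R}) a :
  f = rho fps_X - fps_X -> cong f (rho a) a.
Proof.
move=> frho; have rhoX : cong f (rho fps_X) fps_X.
  by exists 1; rewrite mulr1 frho addrC subrK.
apply/cong_sub0/weierstrass_adic => n.
have [c [b ->]] : exists (c : nat -> R) b,
    a = \sum_(i < n) c i *: fps_X ^+ i + fps_X ^+ n * b.
  by exists (fps_coef a), (fps_shift n a); apply: fps_shiftE.
exists (rho b - b); rewrite raddfD raddf_sum /=.
rewrite opprD addrACA mulrBr -[X in cong _ _ X]add0r; apply: congD.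
  apply/cong_sub0; apply: cong_sum => i; rewrite linearZ rmorphXn /=.
  exact/congZ/congX.
rewrite rmorphM rmorphXn; apply: congD (cong_refl _ _).
by apply: congM (cong_refl _ _); apply: congX.
Qed.

(** Uniqueness of remainders makes a choice of them linear; these coordinates turn operators on the
    quotient into matrices, which have traces. *)
Lemma weierstrass_rem : exists rem : {linear fps R -> 'rV[R]_d},
  (forall g, rem g = 0 <-> cong f g 0) /\
  (forall i : 'I_d, rem (fps_X ^+ i) = delta_mx 0 i).
Proof.
have /choice[c cP] := exactf.1.
have {cP} cP g : cong f g (\sum_(i < d) c g i *: fps_X ^+ i).
  by have [q] := cP g; exists q.
pose rem g : 'rV[R]_d := \row_(i < d) c g i.
have rem_uniq g (b : nat -> R) : cong f g (\sum_(i < d) b i *: fps_X ^+ i) ->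
    rem g = \row_(i < d) b i.
  move=> gb; apply/rowP => i; rewrite !mxE; apply: weierstrass_uniq => //.
  exact: cong_trans (cong_sym (cP g)) gb.
have rem_lin : linear rem.
  move=> a g g'; rewrite (rem_uniq _ (fun i => a * c g i + c g' i)).
    by apply/rowP => i; rewrite !mxE.
  under eq_bigr => i _ do rewrite scalerDl -scalerA.
  rewrite big_split /= -scaler_sumr.
  by apply: congD => //; apply: congZ.
pose remL := HB.pack_for {linear fps R -> 'rV[R]_d} rem
  (GRing.isLinear.Build R (fps R) 'rV[R]_d *:%R rem rem_lin).
exists remL; split=> [g|i]; last first.
  rewrite [LHS](rem_uniq _ (fun j => (j == i)%:R)).
    by apply/rowP => j; rewrite !mxE eqxx.
  rewrite (bigD1 i) //= eqxx scale1r big1 ?addr0; first exact: cong_refl.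
  by move=> j /negPf; rewrite -val_eqE /= => ->; rewrite scale0r.
split=> [rg0|fg]; last first.
  rewrite [LHS](rem_uniq _ (fun=> 0)); first by apply/rowP => j; rewrite !mxE.
  by rewrite [X in cong _ _ X]big1 // => i _; rewrite scale0r.
apply: (cong_trans (cP g)); rewrite big1; first exact: cong_refl.
move=> i _; have /rowP/(_ i) : rem g = 0 := rg0.
by rewrite !mxE => ->; rewrite scale0r.
Qed.

End WeierstrassQuotient.

(** * Telescoping along orbits, and the multiplier at fixed points *)

Lemma iter_telescope (V : zmodType) (s : {additive V -> V}) y n :
  (\sum_(i < n) iter i s (s y - y) = iter n s y - y)%R.
Proof.
elim: n => [|n IHn]; first by rewrite big_ord0 subrr.
rewrite big_ord_recr IHn /= addrC.
have -> : (iter n s (s y - y) = iter n s (s y) - iter n s y)%R.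
  by elim: n {IHn} => //= n ->; rewrite raddfB.
by rewrite -iterSr addrA subrK.
Qed.

Section Multiplier.
Local Open Scope ring_scope.
Variables (S : comNzRingType) (f : S).
Hypothesis reg : forall a b, f * a = f * b -> a = b.
Variable sigma : {rmorphism S -> S}.
Hypothesis sigma_cong : forall a, cong f (sigma a) a.
Variable theta : S.
Hypothesis thetaE : sigma f = f * theta.

Lemma iter_cong n a : cong f (iter n sigma a) a.
Proof.
elim: n => [|n IHn]; first exact: cong_refl.
exact: cong_trans (sigma_cong _) IHn.
Qed.

(** The exact cofactor is the product of the iterates of [theta] under [sigma], each of which is
    congruent to [theta]. *)
Lemma iter_multiplier n : exists2 e, iter n sigma f = f * e & cong f e (theta ^+ n).
Proof.
elim: n => [|n [e fe en]]; first by exists 1; rewrite ?mulr1 //; apply: cong_refl.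
exists (theta * sigma e); first by rewrite iterS fe rmorphM thetaE mulrA.
by rewrite exprS; apply: congMl; apply: cong_trans (sigma_cong _) en.
Qed.

(* [f] times the sum telescopes to [sigma^p y - y] modulo [f^2]. *)
Lemma multiplier_cyclotomic y p : f = sigma y - y -> iter p sigma y = y ->
  cong f (\sum_(i < p) theta ^+ i) 0.
Proof.
move=> fE yp; have /choice[e eP] n : exists e,
    iter n sigma f = f * e /\ cong f e (theta ^+ n).
  by have [e] := iter_multiplier n; exists e.
have e0 : \sum_(i < p) e i = 0.
  apply: reg; rewrite mulr0 mulr_sumr -[RHS](subrr y) -{1}yp -iter_telescope -fE.
  by apply: eq_bigr => i _; rewrite (eP i).1.
apply: (@cong_trans _ _ (\sum_(i < p) e i)); last by rewrite e0; apply: cong_refl.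
by apply: cong_sum => i; apply/cong_sym; apply: (eP i).2.
Qed.

Variables (tau : {rmorphism S -> S}) (u : S).
Hypothesis tau_f : tau f = f * u.

Lemma cong_morph a b : cong f a b -> cong f (tau a) (tau b).
Proof. by case=> q ->; exists (u * tau q); rewrite rmorphD rmorphM tau_f mulrA. Qed.

(** Computing [tau (sigma f)] in two ways and cancelling [f] gives
    [u * tau theta = e * iter c sigma u], whose right side is congruent to [theta ^+ c * u]; then
    the unit [u] cancels. *)
Lemma multiplier_conj c w : u * w = 1 ->
  (forall a, tau (sigma a) = iter c sigma (tau a)) ->
  cong f (tau theta) (theta ^+ c).
Proof.
move=> uw tau_sigma; have [e fe ec] := iter_multiplier c.
have iterM a b : iter c sigma (a * b) = iter c sigma a * iter c sigma b.
  by elim: c {tau_sigma e fe ec} => //= c ->; rewrite rmorphM.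
have : u * tau theta = e * iter c sigma u.
  apply: reg; rewrite mulrA -tau_f -rmorphM -thetaE tau_sigma tau_f iterM fe.
  by rewrite mulrA.
move=> eq_u; rewrite -[tau theta]mul1r -uw mulrAC eq_u -[theta ^+ c]mulr1 -uw.
rewrite -mulrA; apply: congM => //; apply: congM (cong_refl _ _).
exact: iter_cong.
Qed.

End Multiplier.

(** * Vanishing of a trace under a twisted commutation relation *)

Section TwistedTrace.
Local Open Scope ring_scope.

(** Cyclicity of the trace and [D * T = T * D ^+ c] give the sequence [t] the period [c.-1], and
    [D ^+ p = 1] gives it the period [p]. By coprimality [t] is constant, while its sum over [i < p]
    is zero. *)
Lemma twisted_trace (R : comNzRingType) d (T D : 'M[R]_d.+1) p c :
  prime p -> (0 < c)%N -> coprime c.-1 p -> D * T = T * D ^+ c ->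
  \sum_(i < p) D ^+ i = 0 -> p%:R * \tr T = 0.
Proof.
move=> p_pr c_gt0 co_cp DT D0; pose t i := \tr (T * D ^+ i).
have Dp : D ^+ p = 1 by apply/eqP; rewrite -subr_eq0 subrX1 D0 mulr0.
have t_period i n : t (i + n * p)%N = t i.
  by rewrite /t exprD mulnC exprM Dp expr1n mulr1.
have t_shift i : t (i + c.-1)%N = t i.
  have t_succ j : t j.+1 = t (j.+1 + c.-1)%N.
    rewrite addSnnS prednK // /t exprSr mulrA -[LHS]mxtrace_mulC -mulmxE mulmxA.
    by rewrite mulmxE DT -mulrA -exprD addnC.
  (* [t_succ] moves one factor [D] around the trace and so needs a positive exponent; adding the
     period [p] to both sides provides it. *)
  transitivity (t (i + c.-1 + 1 * p)%N); first by rewrite t_period.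
  rewrite -[RHS](t_period i 1%N) mul1n addnAC.
  by rewrite -(prednK (prime_gt0 p_pr)) addnS [RHS]t_succ.
have t_mul n : t (n * c.-1)%N = t 0%N.
  by elim: n => // n IHn; rewrite mulSn addnC t_shift.
have c1_gt0 : (0 < c.-1)%N.
  by case: c.-1 co_cp => //; rewrite /coprime gcd0n => /eqP p1; rewrite p1 in p_pr.
have t_const i : t i = t 0%N.
  (* Bezout gives [km * c.-1 = kn * p + 1]; multiplied by [i], it links [i] to a multiple of [c.-1]
     through a multiple of [p]. *)
  case: (egcdnP p c1_gt0) => km kn bez _; move: bez; rewrite (eqP co_cp) => bez.
  rewrite -(t_period i (i * kn)%N) -mulnA -mulnS -addn1 -bez mulnA.
  exact: t_mul.
have: \tr (T * \sum_(i < p) D ^+ i) = 0 by rewrite D0 mulr0 linear0.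
rewrite mulr_sumr linear_sum /= (eq_bigr (fun=> t 0%N)) => [|i _]; last exact: t_const.
by rewrite sumr_const card_ord /t expr0 mulr1 mulr_natl.
Qed.

End TwistedTrace.

(** * Endomorphisms of [fps k] and [lead], their derivative at the closed point *)

Section LocalAutomorphisms.
Local Open Scope ring_scope.
Variable k : fieldType.
Implicit Types (phi psi : {lrmorphism fps k -> fps k}) (a : fps k).

Definition lead phi : k := fps_coef (phi fps_X) 1.

(** If the constant coefficient [c] of [phi fps_X] were nonzero, [fps_X - c%:A] would be a unit
    whose image has constant coefficient zero. *)
Lemma lrmorph_fps_X phi : exists2 u, phi fps_X = fps_X * u & lead phi = fps_coef u 0.
Proof.
have X0 : fps_coef (phi fps_X) 0 = 0.
  apply/eqP/negPn/negP => c_neq0; set c := fps_coef _ 0 in c_neq0.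
  have [|w Xw] := @fps_unit _ (fps_X - c%:A).
    by rewrite unitfE fps_coefD fps_coefN fps_coefZ /= mulr1 sub0r oppr_eq0.
  have /(congr1 (fun s => fps_coef s 0)) : phi (fps_X - c%:A) * phi w = 1.
    by rewrite -rmorphM Xw rmorph1.
  have -> : phi (fps_X - c%:A) = phi fps_X - c%:A by rewrite rmorphB /= rmorph_alg.
  rewrite fps_coef0M fps_coefD fps_coefN fps_coefZ.
  by rewrite mulr1 -/c subrr mul0r => /esym/eqP; rewrite fps_coef1 oner_eq0.
have Xu := fps_shiftE 1 (phi fps_X); rewrite big_ord1 X0 scale0r add0r expr1 in Xu.
by exists (fps_shift 1 (phi fps_X)).
Qed.

Lemma lrmorph_coef0 phi a : fps_coef (phi a) 0 = fps_coef a 0.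
Proof.
have [u Xu _] := lrmorph_fps_X phi.
have -> : phi a = (fps_coef a 0)%:A + fps_X * (u * phi (fps_shift 1 a)).
  rewrite {1}(fps_shiftE 1 a) big_ord1 expr0 expr1 rmorphD rmorphM /=.
  by rewrite rmorph_alg Xu mulrA.
by rewrite fps_coefD fps_coefXM addr0 fps_coefZ mulr1.
Qed.

Lemma lrmorph_Xn phi n a :
  exists2 b, phi (fps_X ^+ n * a) = fps_X ^+ n * b &
    fps_coef b 0 = lead phi ^+ n * fps_coef a 0.
Proof.
have [u Xu ->] := lrmorph_fps_X phi; exists (u ^+ n * phi a).
  by rewrite rmorphM rmorphXn /= Xu exprMn mulrA.
by rewrite fps_coef0M fps_coef0X lrmorph_coef0.
Qed.

Lemma lrmorph_coefXn phi n : fps_coef (phi (fps_X ^+ n)) n = lead phi ^+ n.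
Proof.
have [b] := lrmorph_Xn phi n 1; rewrite mulr1 => -> b0.
by rewrite fps_coefXnM ltnn subnn b0 fps_coef1 mulr1.
Qed.

Lemma lead_comp phi psi (eta : {lrmorphism fps k -> fps k}) :
  eta =1 phi \o psi -> lead eta = lead phi * lead psi.
Proof.
move=> etaE; rewrite {1}/lead etaE /=; have [v -> ->] := lrmorph_fps_X psi.
have [b] := lrmorph_Xn phi 1 v; rewrite !expr1 => -> b0.
by rewrite fps_coefXM.
Qed.

(** For each [n], [phi] fixes the truncation of a series below degree [n.+1] and sends multiples of
    [fps_X ^+ n.+1] to such multiples. *)
Lemma lrmorph_id phi : phi fps_X = fps_X -> phi =1 id.
Proof.
move=> phiX a; apply: fpsP => n.
have [c [b ->]] : exists (c : nat -> k) b,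
    a = \sum_(i < n.+1) c i *: fps_X ^+ i + fps_X ^+ n.+1 * b.
  by exists (fps_coef a), (fps_shift n.+1 a); apply: fps_shiftE.
set P := \sum_(i < _) _; have phiP : phi P = P.
  rewrite raddf_sum; apply: eq_bigr => i _ /=.
  by rewrite linearZ rmorphXn /= phiX.
have -> : phi (P + fps_X ^+ n.+1 * b) = P + fps_X ^+ n.+1 * phi b.
  by rewrite rmorphD rmorphM rmorphXn /= phiX phiP.
by rewrite !fps_coefD !fps_coefXnM ltnSn.
Qed.

(* If phi X - X = X^n w, then all conjugates of phi X - X have the same
   coefficient of X^n, and these add up to 0. *)
Lemma tame_lead1 phi m : m%:R != 0 :> k -> iter m phi fps_X = fps_X ->
  lead phi = 1 -> phi =1 id.
Proof.
move=> m_neq0 phim lead1; apply: lrmorph_id; apply/eqP; rewrite -subr_eq0.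
set f := _ - _; have divf n : exists w, f = fps_X ^+ n * w.
  elim: n => [|n [w fw]]; first by exists f; rewrite mul1r.
  have iter_lead j : exists2 b,
      iter j phi f = fps_X ^+ n * b & fps_coef b 0 = fps_coef w 0.
    elim: j => [|j [b IHb b0]]; first by exists w.
    have [b' b'E b'0] := lrmorph_Xn phi n b.
    by exists b'; rewrite ?iterS ?IHb // b'0 lead1 expr1n mul1r.
  have /(congr1 (fun s => fps_coef s n)) := iter_telescope phi fps_X m.
  rewrite phim subrr fps_coef_sum (eq_bigr (fun=> fps_coef w 0)) => [|i _].
    rewrite sumr_const card_ord -mulr_natl => /eqP.
    rewrite mulf_eq0 (negPf m_neq0) => /eqP w0.
    exists (fps_shift 1 w); rewrite fw {1}(fps_shiftE 1 w) big_ord1 w0 scale0r.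
    by rewrite add0r expr1 mulrA exprSr.
  by have [b -> <-] := iter_lead i; rewrite fps_coefXnM ltnn subnn.
by apply/eqP/fpsP => n; have [w ->] := divf n.+1; rewrite fps_coefXnM ltnSn.
Qed.

End LocalAutomorphisms.

(** * Group actions on power series *)

Section Actions.
Variables (R : comNzRingType) (gT : finGroupType) (G : {group gT}).
Variable phi : gT -> {lrmorphism fps R -> fps R}.
Hypothesis actG : faithful_action G phi.

Lemma action1 : phi 1 =1 id.
Proof.
have [bij mul _] := actG; move=> a; apply: (bij_inj (bij 1 (group1 G))).
by rewrite -[LHS](mul 1 1 (group1 G) (group1 G)) mulg1.
Qed.

Lemma actionM g h : g \in G -> h \in G -> phi (g * h) =1 phi g \o phi h.
Proof. by case: actG => _ mul _; apply: mul. Qed.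

Lemma actionX g n : g \in G -> phi (g ^+ n) =1 iter n (phi g).
Proof.
move=> Gg; elim: n => [|n IHn] a; first by rewrite expg0 action1.
by rewrite expgS actionM ?groupX //= IHn.
Qed.

Lemma action_faithful g : g \in G -> phi g =1 id -> g = 1.
Proof.
case: actG => _ _ inj Gg g_id; apply: inj => // a.
by rewrite action1 g_id.
Qed.

End Actions.

(** * Matrices and traces of operators on the quotient *)

Section QuotientTrace.
Local Open Scope ring_scope.
Variables (R : idomainType) (f : fps R) (d : nat).
Variable rem : {linear fps R -> 'rV[R]_d}.
Hypothesis remP : forall g, rem g = 0 <-> cong f g 0.
Hypothesis remX : forall i : 'I_d, rem (fps_X ^+ i) = delta_mx 0 i.

Lemma rem_cong a b : cong f a b -> rem a = rem b.
Proof. by move/cong_sub0/remP; rewrite linearB => /eqP; rewrite subr_eq0 => /eqP. Qed.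

Lemma rem_expand g : cong f g (\sum_i rem g 0 i *: fps_X ^+ (i : 'I_d)).
Proof.
apply/cong_sub0/remP; rewrite linearB linear_sum /= [X in X - _]row_sum_delta.
by rewrite -sumrB big1 // => i _; rewrite linearZ /= remX subrr.
Qed.

(** Images are stored as rows, so matrices act from the right and composition reverses the order of
    products. *)
Definition opmx (L : fps R -> fps R) := \matrix_(i < d) rem (L (fps_X ^+ i)).

Lemma rem_op (L : {linear fps R -> fps R}) g :
  (forall a b, cong f a b -> cong f (L a) (L b)) -> rem (L g) = rem g *m opmx L.
Proof.
move=> Lf; rewrite (rem_cong (Lf _ _ (rem_expand g))) !linear_sum mulmx_sum_row.
by apply: eq_bigr => i _; rewrite !linearZ rowK.
Qed.

(** Below degree [d] every multiple of [f] has coefficients in the maximal ideal, so taking the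
    remainder does not change coefficient [i] after reduction. *)
Lemma opmx_trace_coef (k : fieldType) (red : {rmorphism R -> k}) L (i : 'I_d) :
  has_ord (fps_map red f) d -> red (opmx L i i) = red (fps_coef (L (fps_X ^+ i)) i).
Proof.
case=> _ ordf; have [q gE] := rem_expand (L (fps_X ^+ i)).
have low0 : red (fps_coef (f * q) i) = 0.
  rewrite fps_coefM rmorph_sum big1 // => j _; rewrite rmorphM.
  by rewrite [red _](ordf j) ?mul0r // (leq_ltn_trans _ (ltn_ord i)) // -ltnS.
rewrite {1}gE fps_coefD rmorphD low0 addr0 fps_coef_sum (bigD1 i) // big1 => [|j].
  by rewrite fps_coefZ fps_coefXn eqxx mulr1 /= addr0 mxE.
by rewrite fps_coefZ fps_coefXn -val_eqE eq_sym => /negPf /= ->; rewrite mulr0.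
Qed.

End QuotientTrace.

Section MultiplierTrace.
Local Open Scope ring_scope.
Variables (R : idomainType) (f : fps R) (d : nat).
Variable rem : {linear fps R -> 'rV[R]_d.+1}.
Hypothesis remP : forall g, rem g = 0 <-> cong f g 0.
Hypothesis remX : forall i : 'I_d.+1, rem (fps_X ^+ i) = delta_mx 0 i.

(** With [T] the matrix of [tau] and [D] that of multiplication by [theta], the congruence of
    [tau theta] with [theta ^+ c] becomes [D * T = T * D ^+ c], and [twisted_trace] applies. *)
Lemma multiplier_trace (tau : {lrmorphism fps R -> fps R}) theta p c :
  prime p -> p%:R != 0 :> R -> (0 < c)%N -> coprime c.-1 p ->
  (forall a b, cong f a b -> cong f (tau a) (tau b)) ->
  cong f (\sum_(i < p) theta ^+ i) 0 -> cong f (tau theta) (theta ^+ c) ->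
  \tr (opmx rem tau) = 0.
Proof.
move=> p_pr p_neq0 c_gt0 co_cp tau_cong theta_cyc theta_tau.
have mul_lin : linear ( *%R theta) by move=> a g g'; rewrite mulrDr scalerAr.
pose mulL := HB.pack_for {linear fps R -> fps R} ( *%R theta)
  (GRing.isLinear.Build R (fps R) (fps R) *:%R ( *%R theta) mul_lin).
pose T := opmx rem tau; pose D := opmx rem mulL.
have remT g : rem (tau g) = rem g *m T by apply: (rem_op remP remX).
have remD n g : rem (theta ^+ n * g) = rem g *m D ^+ n.
  elim: n => [|n IHn]; first by rewrite !expr0 mul1r mulmx1.
  rewrite exprS -mulrA exprSr -mulmxE mulmxA -IHn -[theta * _]/(mulL _).
  by apply: (rem_op remP remX) => a b; apply: congMl.
have DT : D * T = T * D ^+ c.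
  apply/row_matrixP => i; rewrite !rowE -!mulmxE !mulmxA -remX -remT -remD.
  rewrite -[D]expr1 -remD expr1 -remT rmorphM; apply: (rem_cong remP).
  by apply: congM => //; apply: cong_refl.
have D0 : \sum_(i < p) D ^+ i = 0.
  apply/row_matrixP => i; rewrite row0 rowE mulmx_sumr -remX.
  under eq_bigr => n _ do rewrite -remD.
  rewrite -linear_sum -mulr_suml; apply/remP.
  by rewrite -[X in cong _ _ X](mul0r (fps_X ^+ i)); apply: congM => //; apply: cong_refl.
have /eqP := twisted_trace p_pr c_gt0 co_cp DT D0.
by rewrite mulf_eq0 (negPf p_neq0) => /eqP.
Qed.

End MultiplierTrace.

Lemma coprime_unity_root (R : idomainType) (x : R) a b :
  (0 < a)%N -> coprime a b -> (x ^+ a = 1 -> x ^+ b = 1 -> x = 1)%R.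
Proof.
move=> a_gt0 co_ab xa xb; case: (egcdnP b a_gt0) => km kn.
rewrite (eqP co_ab) => bez _; rewrite -[LHS]expr1.
have : (x ^+ (km * a) = 1)%R by rewrite mulnC exprM xa expr1n.
by rewrite bez exprD mulnC exprM xb expr1n mul1r.
Qed.

(** * The lifted action and its fixed points *)

Section LiftedAction.
Local Open Scope ring_scope.
Variables (R : idomainType) (k : fieldType) (red : {rmorphism R -> k}) (pi : R).
Hypothesis dvrR : is_dvr R.
Hypothesis complR : adically_complete R.
Hypothesis resR : residue_map red.
Hypothesis piR : generates pi (@nonunit R).
Variables (gT : finGroupType) (G : {group gT}).
Variables (phi : gT -> {lrmorphism fps R -> fps R}).
Hypothesis actR : faithful_action G phi.

(* [displacement g = 0] cuts out the fixed points of g in the open disc. *)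
Definition displacement g : fps R := phi g fps_X - fps_X.

Section FixedPoints.
Variables (sigma : gT) (d : nat).
Hypothesis Gsigma : sigma \in G.
Hypothesis ord_sigma : has_ord (fps_map red (displacement sigma)) d.
Let f := displacement sigma.

Lemma displacement_cong a : cong f (phi sigma a) a.
Proof. exact: (aut_cong dvrR complR resR piR ord_sigma). Qed.

Lemma phi_conj tau c a : tau \in G -> (tau * sigma = sigma ^+ c * tau)%g ->
  phi tau (phi sigma a) = iter c (phi sigma) (phi tau a).
Proof.
move=> Gtau tau_sigma; rewrite -[LHS](actionM actR Gtau Gsigma) tau_sigma.
by rewrite (actionM actR) ?groupX //= (actionX actR).
Qed.

(** By the conjugation relation, [phi tau f] is the difference between [phi tau fps_X] and its image
    under the [c]-th iterate of [phi sigma], which is trivial modulo [f]. *)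
Lemma displacement_conj tau c : tau \in G -> (tau * sigma = sigma ^+ c * tau)%g ->
  exists u, phi tau f = f * u.
Proof.
move=> Gtau tau_sigma.
have [q fq] : cong f (phi tau f) 0.
  rewrite rmorphB /= (phi_conj _ Gtau tau_sigma); apply/cong_sub0.
  exact: (iter_cong displacement_cong).
by exists q; rewrite fq add0r.
Qed.

Lemma displacement_stable tau c a b :
  tau \in G -> (tau * sigma = sigma ^+ c * tau)%g ->
  cong f a b -> cong f (phi tau a) (phi tau b).
Proof.
move=> Gtau tau_sigma; have [u fu] := displacement_conj Gtau tau_sigma.
exact: (cong_morph fu).
Qed.

(* theta is the multiplier of sigma at its fixed points, that is, its action
   on the conormal module (f)/(f^2). *)
Lemma displacement_multiplier p : (sigma ^+ p = 1)%g -> exists theta,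
  cong f (\sum_(i < p) theta ^+ i) 0 /\
  forall tau c c', tau \in G -> (tau * sigma = sigma ^+ c * tau)%g ->
    (tau^-1 * sigma = sigma ^+ c' * tau^-1)%g ->
    cong f (phi tau theta) (theta ^+ c).
Proof.
move=> sigma_p; have [q fq] := displacement_cong f.
have thetaE : phi sigma f = f * (1 + q) by rewrite fq mulrDr mulr1.
have reg := weierstrass_regular dvrR complR resR piR ord_sigma.
exists (1 + q); split=> [|tau c c' Gtau tau_sigma tauV_sigma].
  apply: (multiplier_cyclotomic reg displacement_cong thetaE (erefl f)).
  by rewrite -[LHS](actionX actR p Gsigma) sigma_p (action1 actR).
have [u fu] := displacement_conj Gtau tau_sigma.
have [v fv] := displacement_conj (groupVr Gtau) tauV_sigma.
(* The inverse of [u] comes from the inverse of [tau]: applying [phi tau] to the equation [fv] gives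
   [f = f * (u * phi tau v)]. *)
apply: (multiplier_conj reg displacement_cong thetaE fu (w := phi tau v)).
  apply: reg; rewrite mulrA -fu mulr1 -rmorphM -fv.
  by rewrite -[LHS](actionM actR Gtau (groupVr Gtau)) mulgV (action1 actR).
by move=> a; apply: phi_conj.
Qed.

End FixedPoints.

Variable p : nat.
Hypothesis p_pr : prime p.
Hypothesis p_neq0 : p%:R != 0 :> R.

(** The sum is the reduction of the trace of [phi tau] on the quotient, which vanishes by
    [multiplier_trace]. *)
Lemma displacement_trace sigma tau d c c' :
  sigma \in G -> has_ord (fps_map red (displacement sigma)) d.+1 ->
  (sigma ^+ p = 1)%g -> tau \in G -> (tau * sigma = sigma ^+ c * tau)%g ->
  (tau^-1 * sigma = sigma ^+ c' * tau^-1)%g -> (0 < c)%N -> coprime c.-1 p ->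
  \sum_(i < d.+1) red (fps_coef (phi tau (fps_X ^+ i)) i) = 0.
Proof.
move=> Gsigma ord_sigma sigma_p Gtau tau_sigma tauV_sigma c_gt0 co_cp.
have [theta [theta_cyc theta_tau]] :=
  displacement_multiplier Gsigma ord_sigma sigma_p.
have [rem [remP remX]] := weierstrass_rem dvrR complR resR piR ord_sigma.
have tr0 := multiplier_trace remP remX p_pr p_neq0 c_gt0 co_cp
  (fun a b => displacement_stable Gsigma ord_sigma Gtau tau_sigma)
  theta_cyc (theta_tau _ _ _ Gtau tau_sigma tauV_sigma).
rewrite -[RHS](rmorph0 red) -tr0 rmorph_sum; apply: eq_bigr => i _.
by rewrite (opmx_trace_coef remP remX).
Qed.

(* The fixed point of t is fixed by the whole centralizer of t, hence so is the
   multiplier of sigma at that point; the latter is a primitive p-th root of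
   unity, on which tau acts by raising to the power c. *)
Lemma displacement_fixed sigma tau t d c c' :
  sigma \in G -> has_ord (fps_map red (displacement sigma)) d ->
  (sigma ^+ p = 1)%g -> tau \in G -> (tau * sigma = sigma ^+ c * tau)%g ->
  (tau^-1 * sigma = sigma ^+ c' * tau^-1)%g -> (0 < c)%N ->
  t \in G -> has_ord (fps_map red (displacement t)) 1 ->
  commute sigma t -> commute tau t -> ~~ coprime c.-1 p.
Proof.
move=> Gsigma ord_sigma sigma_p Gtau tau_sigma tauV_sigma c_gt0 Gt ord_t.
move=> sigma_t tau_t; set x := displacement t.
have [theta [theta_cyc theta_tau]] :=
  displacement_multiplier Gsigma ord_sigma sigma_p.
have const a : exists r, cong x a r%:A.
  have [r [q ->]] := (weierstrass_division dvrR complR resR piR ord_t).1 a.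
  by exists (r 0%N), q; rewrite big_ord1.
(* Since [x] has Weierstrass degree one, every series is constant modulo [x]; [phi g] fixes
   constants and preserves congruence modulo [x]. *)
have fixx g a : g \in G -> commute g t -> cong x (phi g a) a.
  move=> Gg gt; have [r ar] := const a.
  apply: (@cong_trans _ _ r%:A); last exact: cong_sym.
  rewrite -[X in cong _ _ X](rmorph_alg (phi g)).
  by apply: (displacement_stable (c := 1) Gt ord_t Gg) => //; rewrite expg1.
(* The displacement of [sigma] is thus a multiple of [x], so congruences modulo it specialize to the
   fixed point of [t]. *)
have [q fq] := fixx _ fps_X Gsigma sigma_t.
have f_x a b : cong (displacement sigma) a b -> cong x a b.
  case=> s ->; exists (q * s); rewrite mulrA; congr (_ + _ * _).
  by rewrite /displacement fq addrC addKr.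
have [r theta_r] := const theta.
have const0 a : cong x a%:A 0 -> a = 0.
  exact: (weierstrass_const dvrR complR resR piR ord_t).
have algX n : (r%:A : fps R) ^+ n = (r ^+ n)%:A by rewrite exprZn expr1n.
have r_cyc : \sum_(i < p) r ^+ i = 0.
  apply: const0; rewrite scaler_suml; apply: cong_trans (f_x _ _ theta_cyc).
  apply: cong_sum => i; rewrite -algX; apply: congX; exact: cong_sym.
have rc : r ^+ c = r.
  apply/eqP; rewrite -subr_eq0; apply/eqP/const0; rewrite scalerBl -algX.
  apply/cong_sub0; apply: (@cong_trans _ _ (theta ^+ c)).
    exact/congX/cong_sym.
  apply: cong_trans theta_r; apply: cong_trans (fixx _ theta Gtau tau_t).
  by apply/cong_sym/f_x; apply: theta_tau tauV_sigma.
have rp : r ^+ p = 1 by apply/eqP; rewrite -subr_eq0 subrX1 r_cyc mulr0.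
have r_neq0 : r != 0.
  apply/eqP => r0; move/eqP: rp; rewrite r0 expr0n.
  by rewrite (gtn_eqF (prime_gt0 p_pr)) eq_sym oner_eq0.
have rc1 : r ^+ c.-1 = 1.
  by apply: (mulfI r_neq0); rewrite -exprS prednK // rc mulr1.
(* Coprimality would give [r = 1], turning the cyclotomic sum [r_cyc] into [p%:R = 0]. *)
apply/negP; rewrite coprime_sym => co_pc.
move: r_cyc; rewrite (coprime_unity_root (prime_gt0 p_pr) co_pc rp rc1).
under eq_bigr => i _ do rewrite expr1n.
by rewrite sumr_const card_ord => /eqP; rewrite (negPf p_neq0).
Qed.

End LiftedAction.

(** * Comparison of the lifted action with [chi], the conductor and the order of [C] *)

Theorem proposition1p3 (k : closedFieldType) (p : nat) (hp : p \in [pchar k]%R)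
  (gT : finGroupType) (G P C : {group gT}) (m : nat)
  (hP : cyclic P) (oP : #|P| = p)
  (hC : cyclic C) (oC : #|C| = m) (hmp : coprime m p)
  (chi : {morphism C >-> {unit 'F_p}})
  (hG : P ><| C = G)
  (hchi : forall sigma tau, sigma \in P -> tau \in C ->
    tau * sigma * tau^-1 = sigma ^+ (val (chi tau) : 'F_p))
  (phi : gT -> {lrmorphism fps k -> fps k})
  (hphi : faithful_action G phi)
  (h : nat) (hh : has_conductor P phi h)
  (hlift : lifts_to_char0 G phi) :
  ((forall tau, tau \in C -> chi tau = 1) \/ 'injm chi) /\
  ('injm chi -> (m %| h.+1)%N).
Proof.
have p_pr := pcharf_prime hp.
have [/andP[sPG _] sCG _ _ _] := sdprod_context hG.
case: hh => sigma gen_sigma [u [phi_sigma [uh u0]]].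
case: hlift => R [red [phiR [dvrR complR resR charR [actR compat]]]].
have [pidR idealR _] := dvrR; have [pi piR] := pidR _ idealR.
have Psigma : sigma \in P by rewrite (eqP gen_sigma) cycle_id.
have Gsigma := subsetP sPG _ Psigma.
have sigma_p : sigma ^+ p = 1 by rewrite -oP expg_cardG.
have p_neq0 : (p%:R != 0 :> R)%R.
  apply/eqP => p0; have := charR p; rewrite !inE p_pr.
  by rewrite -(rmorph_nat (@tofrac R)) p0 rmorph0 eqxx.
have red_disp g : g \in G ->
    fps_map red (displacement phiR g) = (phi g fps_X - fps_X)%R.
  by move=> Gg; rewrite rmorphB /= compat // fps_mapX.
(* The displacement reduces to [fps_X * (u - 1)], of order one more than the conductor; hence the
   rank [h.+1]. *)
have ord_sigma : has_ord (fps_map red (displacement phiR sigma)) h.+1.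
  have -> : fps_map red (displacement phiR sigma) = (fps_X * (u - 1))%R.
    by rewrite red_disp // phi_sigma mulrBr mulr1.
  split=> [|[|i] ih]; rewrite fps_coefXM //; exact: u0.
pose c tau : nat := val (chi tau) : 'F_p.
have c_conj tau : tau \in C -> tau * sigma = sigma ^+ c tau * tau.
  by move=> Ctau; rewrite -hchi // mulgKV.
have c_gt0 tau : (0 < c tau)%N.
  have := valP (chi tau); rewrite unitfE lt0n; apply: contra => /eqP c0.
  exact/eqP/val_inj.
have c_lt tau : (c tau < p)%N by rewrite -[X in (_ < X)%N](Fp_cast p_pr) ltn_ord.
have c1_chi tau : c tau = 1%N -> chi tau = 1.
  move=> c1; apply/val_inj/val_inj; rewrite [LHS]c1 /=.
  by rewrite modn_small.
(* When [chi tau] is not 1, [(c tau).-1] lies strictly between 0 and [p]. *)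
have c_coprime tau : chi tau != 1 -> coprime (c tau).-1 p.
  move=> chi1; rewrite coprime_sym prime_coprime // gtnNdvd //.
    move: (c_gt0 tau) (c1_chi tau) chi1; case: (c tau) => // -[|n] // _.
    by move=> /(_ erefl) ->; rewrite eqxx.
  exact: leq_ltn_trans (leq_pred _) (c_lt tau).
have m_neq0 : (m%:R != 0 :> k)%R.
  by rewrite -(dvdn_pcharf hp) -prime_coprime // coprime_sym.
(* Here [tau ^+ m = 1] with [m] invertible in [k], so tameness makes [lead] faithful on [C]. *)
have lead1 tau : tau \in C -> lead (phi tau) = 1%R -> tau = 1.
  move=> Ctau lead_tau; have Gtau := subsetP sCG _ Ctau.
  apply: (action_faithful hphi Gtau); apply: tame_lead1 m_neq0 _ lead_tau.
  rewrite -[LHS](actionX hphi m Gtau) -oC expg_cardG //.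
  exact: (action1 hphi).
have c_conjV tau : tau \in C -> tau^-1 * sigma = sigma ^+ c tau^-1 * tau^-1.
  by move=> Ctau; apply: c_conj; rewrite groupV.
split=> [|inj_chi]; last first.
  have /cyclicP[tau defC] := hC; have Ctau : tau \in C by rewrite defC cycle_id.
  have Gtau := subsetP sCG _ Ctau.
  (* A trivial [C] has [m = 1]; otherwise injectivity gives [chi tau != 1], as the trace argument
     requires. *)
  have [tau1|tau_neq1] := eqVneq tau 1.
    by rewrite -oC defC tau1 cycle1 cards1 dvd1n.
  have chi_neq1 : chi tau != 1.
    apply: contra tau_neq1 => /eqP chi1; apply/eqP.
    by apply: (injmP inj_chi) => //; rewrite morph1.
  have lead_sum : (\sum_(i < h.+1) lead (phi tau) ^+ i = 0)%R.
    rewrite -[RHS](displacement_trace dvrR complR resR piR actR p_pr p_neq0 Gsigma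
      ord_sigma sigma_p Gtau (c_conj _ Ctau) (c_conjV _ Ctau) (c_gt0 _)
      (c_coprime _ chi_neq1)).
    apply: eq_bigr => i _; rewrite -lrmorph_coefXn -(fps_mapX red) -rmorphXn.
    by rewrite -compat.
  (* As [tau] generates [C], divisibility means [tau ^+ h.+1 = 1]. By [lead1] it suffices that
     [lead (phi tau) ^+ h.+1 = 1], which the geometric sum [lead_sum] yields. *)
  rewrite -oC defC -orderE order_dvdn; apply/eqP/lead1; first exact: groupX.
  have leadX n : lead (phi (tau ^+ n)) = (lead (phi tau) ^+ n)%R.
    elim: n => [|n IHn]; first by rewrite /lead (action1 hphi).
    rewrite expgS exprS -IHn; apply: lead_comp.
    by apply: (actionM hphi); rewrite ?groupX.
  by rewrite leadX; apply/eqP; rewrite -subr_eq0 subrX1 lead_sum mulr0.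
have [|ninj] := boolP ('injm chi); [by right|left=> tau Ctau].
have /subsetPn[t] := ninj; rewrite !inE => /andP[Ct /eqP chit] t_neq1.
have Gt := subsetP sCG _ Ct; have Gtau := subsetP sCG _ Ctau.
(* By [lead1] the derivative of [phi t] differs from 1, so its displacement has order exactly
   one. *)
have ord_t : has_ord (fps_map red (displacement phiR t)) 1.
  have [v phi_t lead_t] := lrmorph_fps_X (phi t); rewrite red_disp //; split.
    rewrite fps_coefD fps_coefN subr_eq0; apply: contra t_neq1 => /eqP lead_t1.
    by apply/eqP/lead1.
  by case=> // _; rewrite phi_t fps_coefD fps_coefN fps_coefXM subrr.
have sigma_t : commute sigma t.
  rewrite /commute c_conj // /c chit /=.
  by rewrite modn_small.
have tau_t : commute tau t by apply: (centsP (cyclic_abelian hC)).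
apply/eqP/negPn/negP => /c_coprime; apply/negP.
exact: (displacement_fixed dvrR complR resR piR actR p_pr p_neq0 Gsigma
  ord_sigma sigma_p Gtau (c_conj _ Ctau) (c_conjV _ Ctau) (c_gt0 _) Gt ord_t).
Qed.
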